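(* Let $n\ge 1$. The map $\rho:\mathrm{gl}(n,\mathbb{R})\to\mathrm{gl}\big(\binom{n+1}{2},\mathbb{R}\big)$ defined by $\rho(A):=L_2(A)$, where $L_2(A)$ is the lower Schläflian matrix of order $2$ of $A$, is a guardian representation.
   Context: Lower Schläflian matrix of order 2. For $z\in\mathbb{R}^n$, let $s_2(z)\in\mathbb{R}^{\binom{n+1}{2}}$ be the vector listing, in lexicographic order, all monomials $z_1^{p_1}\cdots z_n^{p_n}$ with non-negative integers $p_i$ satisfying $\sum_{i=1}^n p_i=2$, i.e. $s_2(z)=(z_1^2,z_1z_2,\dots,z_1z_n,z_2^2,z_2z_3,\dots,z_n^2)^\top$. For $A\in\mathbb{R}^{n\times n}$, $L_2(A)$ is the (unique) $\binom{n+1}{2}\times\binom{n+1}{2}$ real matrix such that whenever $\dot z(t)=Az(t)$ one has $\frac{d}{dt}s_2(z(t))=L_2(A)\,s_2(z(t))$. For example, for $n=2$, $$L_2(A)=\begin{bmatrix}2a_{11}&2a_{12}&0\\ a_{21}&a_{11}+a_{22}&a_{12}\\ 0&2a_{21}&2a_{22}\end{bmatrix}.$$ Lie algebra representations. $\mathrm{gl}(n,\mathbb{R})$ is the Lie algebra of all real $n\times n$ matrices with bracket $[A,B]=AB-BA$. A linear map $\rho:\mathrm{gl}(n,\mathbb{R})\to\mathrm{gl}(m,\mathbb{R})$ is a Lie algebra representation if $\rho([A,B])=[\rho(A),\rho(B)]$ for all $A,B\in\mathrm{gl}(n,\mathbb{R})$. Guardian representations. Let $\lambda_1(A),\dots,\lambda_n(A)$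 denote the (complex) eigenvalues of $A\in\mathbb{R}^{n\times n}$. Consider the following two conditions on a function $f:\mathbb{R}^{n\times n}\to\mathbb{R}$: (G1) $f(A)\neq 0$ whenever $\mathrm{Re}(\lambda_i(A))<0$ for all $i$, and $f(A)=0$ whenever $\mathrm{Re}(\lambda_i(A))=0$ for some $i$; (G2) $f(A)\neq 0$ whenever $\mathrm{Re}(\lambda_i(A))<0$ for all $i$, and $f(A)=0$ whenever $A$ has an eigenvalue $\mathrm{i}\beta$ with $\beta\in\mathbb{R}$, $\beta\ne 0$. A map $\rho:\mathrm{gl}(n,\mathbb{R})\to\mathrm{gl}(m,\mathbb{R})$ is a guardian representation if it is a Lie algebra representation and the function $A\mapsto\det(\rho(A))$ satisfies (G1) or (G2). *)

(* Defs.v *)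
From HB Require Import structures.
From mathcomp Require Import all_boot all_order all_algebra.
From mathcomp Require Import complex.
From mathcomp Require Import boolp classical_sets reals topology normedtype derive.

Set Implicit Arguments.
Unset Strict Implicit.
Unset Printing Implicit Defensive.

Import Order.TTheory GRing.Theory Num.Theory.
Import numFieldNormedType.Exports.

Local Open Scope classical_set_scope.
Local Open Scope ring_scope.

(* Indices (i, j), i <= j, of the monomials z_i z_j of degree 2, in
   lexicographic order: (0,0), (0,1), ..., (0,n-1), (1,1), (1,2), ... *)
Definition deg2_indices (n : nat) : seq ('I_n * 'I_n) :=
  [seq (i, j) | i : 'I_n <- enum 'I_n, j : 'I_n <- [seq j : 'I_n <- enum 'I_n | (i <= j)%N]].

Lemma size_deg2_indices (n : nat) : size (deg2_indices n) = 'C(n.+1, 2).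
Proof.
have cnt m : (m <= n)%N -> count (leq m) (iota 0 n) = (n - m)%N.
  move=> mn; rewrite -{1}(subnKC mn) iotaD count_cat add0n.
  rewrite (@eq_in_count _ _ pred0); last first.
    by move=> k; rewrite mem_iota /= add0n ltnNge => /negbTE.
  rewrite count_pred0 add0n (@eq_in_count _ _ predT) ?count_predT ?size_iota//.
  by move=> k; rewrite mem_iota => /andP[].
rewrite size_allpairs_dep sumnE big_map big_enum /=.
rewrite (eq_bigr (fun i : 'I_n => n - i)%N) => [|i _]; last first.
  by rewrite size_filter -(count_map val (leq i)) val_enum_ord cnt// ltnW.
rewrite -bin2_sum big_mkord big_ord_recl add0n (reindex_inj rev_ord_inj) /=.
by apply: eq_bigr => i _; rewrite subKn.
Qed.

(* The default value 0 of the sequence access is never reached, by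
   size_deg2_indices. *)
Definition s2 (R : realType) (n : nat) (z : 'cV[R]_n) : 'cV[R]_('C(n.+1, 2)) :=
  \col_(k < 'C(n.+1, 2))
    [seq z ij.1 ord0 * z ij.2 ord0 | ij <- deg2_indices n]`_k.

(* z' = M z on the whole real line; differentiation is entrywise. *)
Definition linear_ode (R : realType) (m : nat) (M : 'M[R]_m)
    (z : R -> 'cV[R]_m) : Prop :=
  forall (t : R) (i : 'I_m),
    is_derive t 1 (fun u : R => z u i ord0) ((M *m z t) i ord0).

Definition is_lower_schlaflian2 (R : realType) (n : nat) (A : 'M[R]_n)
    (L : 'M[R]_('C(n.+1, 2))) : Prop :=
  forall z : R -> 'cV[R]_n,
    linear_ode A z -> linear_ode L (fun t => s2 (z t)).

(* L_2(A), by definite description; the default 0 is irrelevant since exactly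
   one matrix satisfies is_lower_schlaflian2 A. *)
Definition lower_schlaflian2 (R : realType) (n : nat) (A : 'M[R]_n) :
    'M[R]_('C(n.+1, 2)) :=
  xget 0 [set L | is_lower_schlaflian2 A L].

Definition lie_bracket (R : realType) (n : nat) (A B : 'M[R]_n) : 'M[R]_n :=
  A *m B - B *m A.

Definition lie_representation (R : realType) (n m : nat)
    (rho : 'M[R]_n -> 'M[R]_m) : Prop :=
  linear rho /\
  forall A B, rho (lie_bracket A B) = lie_bracket (rho A) (rho B).

Definition complex_eigenvalue (R : realType) (n : nat) (A : 'M[R]_n)
    (lambda : R[i]) : Prop :=
  eigenvalue (map_mx (real_complex R) A) lambda.

Definition hurwitz (R : realType) (n : nat) (A : 'M[R]_n) : Prop :=
  forall lambda : R[i], complex_eigenvalue A lambda -> complex.Re lambda < 0.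

Definition G1 (R : realType) (n : nat) (f : 'M[R]_n -> R) : Prop :=
  (forall A, hurwitz A -> f A <> 0) /\
  (forall A, (exists lambda : R[i],
     complex_eigenvalue A lambda /\ complex.Re lambda = 0) -> f A = 0).

Definition G2 (R : realType) (n : nat) (f : 'M[R]_n -> R) : Prop :=
  (forall A, hurwitz A -> f A <> 0) /\
  (forall A, (exists beta : R,
     beta <> 0 /\ complex_eigenvalue A (Complex 0 beta)) -> f A = 0).

Definition guardian_representation (R : realType) (n m : nat)
    (rho : 'M[R]_n -> 'M[R]_m) : Prop :=
  lie_representation rho /\
  (G1 (fun A => \det (rho A)) \/ G2 (fun A => \det (rho A))).

(* Main.v *)
Require Import Defs.
From HB Require Import structures.
From mathcomp Require Import all_boot all_order all_algebra.
From mathcomp Require Import complex ring.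
From mathcomp Require Import boolp classical_sets functions reals.
From mathcomp Require Import topology normedtype sequences derive exp.

Set Implicit Arguments.
Unset Strict Implicit.
Unset Printing Implicit Defensive.

Import Order.TTheory GRing.Theory Num.Theory.
Import numFieldNormedType.Exports.

Local Open Scope classical_set_scope.
Local Open Scope ring_scope.

(** Since [s_2(z)] lists the upper triangular entries of [z z^T], [L_2(A)] is
the matrix of the Lyapunov operator [S |-> A S + S A^T] on symmetric matrices,
which is visibly a Lie algebra representation in [A].  It is the only such
matrix because the flow of [A] passes through every [z] and the [s_2(z)] span.
If [A] is Hurwitz, [A] and [-A^T] have disjoint spectra, so by Cayley-Hamilton
[A S = S (-A^T)] forces [S = 0] and [L_2(A)] is invertible.  If [x + i y] is an
eigenvector of [A] for an imaginary eigenvalue, [x x^T + y y^T] is a nonzero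
element of the kernel; hence (G1) holds. *)

(** * Indexing of the degree 2 monomials *)

Definition deg2_tuple (n : nat) : 'C(n.+1, 2).-tuple ('I_n * 'I_n) :=
  Tuple (introT eqP (size_deg2_indices n)).

Definition deg2_index (n : nat) (k : 'I_('C(n.+1, 2))) : 'I_n * 'I_n :=
  tnth (deg2_tuple n) k.

Lemma mem_deg2_indices n (ij : 'I_n * 'I_n) :
  (ij \in deg2_indices n) = (ij.1 <= ij.2)%N.
Proof.
case: ij => i j; apply/allpairsPdep/idP => [[i' [j' [_ + [-> ->]]]]|/= ij].
  by rewrite mem_filter => /andP[].
exists i, j; split; rewrite ?mem_enum//.
by rewrite mem_filter ij mem_enum.
Qed.

Lemma deg2_index_le n (k : 'I_('C(n.+1, 2))) :
  ((deg2_index k).1 <= (deg2_index k).2)%N.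
Proof. by rewrite -mem_deg2_indices; apply: (mem_tnth k (deg2_tuple n)). Qed.

Lemma deg2_index_inj n : injective (@deg2_index n).
Proof.
apply/tuple_uniqP; apply: allpairs_uniq_dep => //.
- exact: enum_uniq.
- by move=> i _; rewrite filter_uniq// enum_uniq.
- by move=> [i j] [i' j'] _ _ /= [-> ->].
Qed.

Lemma deg2_index_onto n (i j : 'I_n) :
  (i <= j)%N -> exists k, deg2_index k = (i, j).
Proof.
rewrite -(mem_deg2_indices (i, j)) => ij.
by have /tnthP[k ->] : (i, j) \in deg2_tuple n by []; exists k.
Qed.

(** * Symmetric matrices as vectors, and the matrix of the Lyapunov operator *)

Section HalfVectorization.
Variables (R : realType) (n : nat).
Implicit Types (S : 'M[R]_n) (v : 'cV[R]_('C(n.+1, 2))).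

Definition vech S : 'cV[R]_('C(n.+1, 2)) :=
  \col_k S (deg2_index k).1 (deg2_index k).2.

(** The sum has exactly one term: one of [(i, j)], [(j, i)] is ordered, and the disjunction counts a
    diagonal index once. This form makes linearity immediate. *)
Definition unvech v : 'M[R]_n :=
  \matrix_(i, j) \sum_(k | (deg2_index k == (i, j)) || (deg2_index k == (j, i)))
    v k 0.

Lemma vech_linear : linear vech.
Proof. by move=> a S T; apply/colP => k; rewrite !mxE. Qed.

HB.instance Definition _ :=
  GRing.isLinear.Build R 'M[R]_n 'cV[R]_('C(n.+1, 2)) _ vech vech_linear.

Lemma unvech_linear : linear unvech.
Proof.
move=> a u v; apply/matrixP => i j; rewrite !mxE mulr_sumr -big_split /=.
by apply: eq_bigr => k _; rewrite !mxE.
Qed.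

HB.instance Definition _ :=
  GRing.isLinear.Build R 'cV[R]_('C(n.+1, 2)) 'M[R]_n _ unvech unvech_linear.

Lemma unvech_sym v : (unvech v)^T = unvech v.
Proof.
by apply/matrixP => i j; rewrite !mxE; apply: eq_bigl => k; rewrite orbC.
Qed.

Lemma unvech_index v k0 i j :
  (deg2_index k0 == (i, j)) || (deg2_index k0 == (j, i)) ->
  unvech v i j = v k0 0.
Proof.
move=> k0ij; rewrite mxE (big_pred1 k0)// => k; apply/idP/eqP => [kij|->//].
apply: deg2_index_inj; have := deg2_index_le k; have := deg2_index_le k0.
by case/orP: k0ij kij => /eqP -> /orP[] /eqP -> //= h1 h2;
  have/val_inj-> : (i : nat) = j by apply/eqP; rewrite eqn_leq h1 h2.
Qed.

Lemma unvechK : cancel unvech vech.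
Proof.
move=> v; apply/colP => k; rewrite mxE.
by rewrite (@unvech_index v k)// -surjective_pairing eqxx.
Qed.

Lemma vechK S : S^T = S -> unvech (vech S) = S.
Proof.
move=> Ssym; apply/matrixP => i j.
have [ij|/ltnW ji] := leqP i j.
  have [k kij] := deg2_index_onto ij.
  by rewrite (@unvech_index _ k) ?kij ?eqxx// mxE kij.
have [k kij] := deg2_index_onto ji.
by rewrite (@unvech_index _ k) ?kij ?eqxx ?orbT// mxE kij -[in LHS]Ssym mxE.
Qed.

Lemma s2E (z : 'cV[R]_n) : s2 z = vech (z *m z^T).
Proof.
apply/colP => k; rewrite !mxE big_ord1 !mxE.
rewrite (nth_map (deg2_index k)) ?size_deg2_indices//.
by rewrite -(tnth_nth (deg2_index k) (deg2_tuple n)).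
Qed.

Definition lyapunov_vech (A : 'M[R]_n) v : 'cV[R]_('C(n.+1, 2)) :=
  vech (A *m unvech v + unvech v *m A^T).

Lemma lyapunov_vech_linear A : linear (lyapunov_vech A).
Proof.
move=> a u v; rewrite /lyapunov_vech -linearP; congr vech.
by rewrite linearP mulmxDr mulmxDl -scalemxAr -scalemxAl scalerDr addrACA.
Qed.

HB.instance Definition _ A := GRing.isLinear.Build R
  'cV[R]_('C(n.+1, 2)) 'cV[R]_('C(n.+1, 2)) _
  (lyapunov_vech A) (lyapunov_vech_linear A).

Definition lyapunov_mx (A : 'M[R]_n) : 'M[R]_('C(n.+1, 2)) :=
  \matrix_(k, l) lyapunov_vech A (delta_mx l 0) k 0.

Lemma lyapunov_mxE A v : lyapunov_mx A *m v = lyapunov_vech A v.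
Proof.
rewrite {2}(matrix_sum_delta v) linear_sum; apply/colP => k.
rewrite mxE summxE; apply: eq_bigr => l _.
by rewrite big_ord1 linearZ !mxE mulrC.
Qed.

Lemma lyapunov_mx_vech A S :
  S^T = S -> lyapunov_mx A *m vech S = vech (A *m S + S *m A^T).
Proof. by move=> Ssym; rewrite lyapunov_mxE /lyapunov_vech vechK. Qed.

(** Polarization: the matrices [x *m x^T] generate all [x *m y^T + y *m x^T], hence the symmetrized
    matrix units, and these span the symmetric matrices. *)
Lemma s2_separates (L : 'M[R]_('C(n.+1, 2))) :
  (forall z, L *m s2 z = 0) -> L = 0.
Proof.
move=> Ls2.
have polar (x y : 'cV[R]_n) : L *m vech (x *m y^T + y *m x^T) = 0.
  have -> : x *m y^T + y *m x^T =
      (x + y) *m (x + y)^T - x *m x^T - y *m y^T.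
    by apply/matrixP => i j; rewrite !mxE !big_ord1 !mxE; ring.
  by rewrite !linearB /= -!s2E !Ls2 !subr0.
have Lsym S : S^T = S -> L *m vech S = 0.
  (* Doubling turns [S] into [S + S^T], so that the matrix units at [(i, j)] and [(j, i)] pair up
     with the same coefficient. *)
  move=> Ssym; apply: (@scalerI _ _ (2 : R)); first by rewrite pnatr_eq0.
  rewrite scaler0 scalemxAr -linearZ /= scaler_nat mulr2n -{2}Ssym.
  rewrite {1 2}(matrix_sum_delta S) linear_sum -big_split /= linear_sum.
  rewrite linear_sum big1//= => i _; rewrite linear_sum -big_split /=.
  rewrite !linear_sum big1//= => j _; rewrite linearZ -scalerDr /=.
  have deltaE k l : delta_mx k l = delta_mx k (0 : 'I_1) *m (delta_mx l 0)^T :> 'M[R]_n.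
    by rewrite trmx_delta mul_delta_mx.
  by rewrite !linearZ /= trmx_delta !deltaE polar scaler0.
(* Each basis vector is [vech] of a symmetric matrix, so every column of [L] vanishes. *)
apply/row_matrixP => i; apply/rowP => k.
have := Lsym _ (unvech_sym (delta_mx k 0)); rewrite unvechK => /colP/(_ i).
by rewrite -colE !mxE.
Qed.

End HalfVectorization.

(** * The exponential flow of a matrix *)

Section LinearODE.
Variables (R : realType) (n : nat) (A : 'M[R]_n).
Implicit Types (x : 'cV[R]_n).

(** The coefficient of [t ^+ k] in entry [i] of exp(tA)x. Working entry by entry allows termwise
    differentiation of scalar power series. *)
Definition exp_coef x (i : 'I_n) (k : nat) : R :=
  iter k (mulmx A) x i 0 / k`!%:R.

Definition exp_flow x (t : R) : 'cV[R]_n :=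
  \col_i limn (pseries (exp_coef x i) t).

Lemma exp_coef_diffs x i :
  pseries_diffs (exp_coef x i) = exp_coef (A *m x) i.
Proof.
apply/funext => k; rewrite /pseries_diffs /exp_coef iterSr factS natrM invfM.
by rewrite mulrCA mulVKf ?pnatr_eq0.
Qed.

Lemma exp_coef_mulmx x i k :
  exp_coef (A *m x) i k = \sum_j A i j * exp_coef x j k.
Proof.
rewrite /exp_coef -iterSr iterS mxE mulr_suml.
by apply: eq_bigr => j _; rewrite mulrA.
Qed.

(** The induction on [k] runs in the sum norm, for which the sum of all [|A i j|] bounds the
    operator norm; a single entry is at most the sum norm. *)
Lemma norm_iter_mulmx x i k :
  `|iter k (mulmx A) x i 0| <=
  (\sum_i \sum_j `|A i j|) ^+ k * \sum_j `|x j 0|.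
Proof.
set M : R := \sum_i _.
have mulA (y : 'cV[R]_n) : \sum_i `|(A *m y) i 0| <= M * \sum_j `|y j 0|.
  rewrite mulr_suml; apply: ler_sum => i' _; rewrite mxE mulr_suml.
  apply: le_trans (ler_norm_sum _ _ _) _; apply: ler_sum => j _.
  rewrite normrM ler_wpM2l// (bigD1 j)//= lerDl.
  by apply: sumr_ge0.
have -> : M ^+ k * \sum_j `|x j 0| = iter k ( *%R M) (\sum_j `|x j 0|).
  by rewrite iter_mulr.
have M0 : 0 <= M by apply: sumr_ge0 => *; apply: sumr_ge0.
apply: (@le_trans _ _ (\sum_i `|iter k (mulmx A) x i 0|)).
  by rewrite (bigD1 i)//= lerDl sumr_ge0.
elim: k => // k IHk; rewrite !iterS.
apply: (le_trans (mulA _)); exact: ler_wpM2l.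
Qed.

(** Absolute convergence, by comparison with [B] times the exponential series at [M * |t|]. *)
Lemma cvg_exp_coef x i t : cvgn (pseries (exp_coef x i) t).
Proof.
apply: normed_cvg; rewrite /normed_series_of /=.
set M : R := \sum_i \sum_j `|A i j|; set B : R := \sum_j `|x j 0|.
have M0 : 0 <= M by apply: sumr_ge0 => *; apply: sumr_ge0.
have B0 : 0 <= B by apply: sumr_ge0.
have cvgB : cvgn (series (fun k => B * exp_coeff (M * `|t|) k)).
  exact: (@is_cvg_seriesZ R _ B (is_cvg_series_exp_coeff _)).
apply: (series_le_cvg _ _ _ cvgB) => [//|k|k].
- by rewrite mulr_ge0// exp_coeff_ge0// mulr_ge0.
- rewrite /exp_coef /exp_coeff /= !normrM normfV normrX normr_nat exprMn.
  rewrite mulrAC !mulrA ler_wpM2r ?invr_ge0//.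
  by rewrite ler_wpM2r ?exprn_ge0// [leRHS]mulrC norm_iter_mulmx.
Qed.

Lemma exp_flow0 x : exp_flow x 0 = x.
Proof.
apply/colP => i; rewrite mxE.
(* The partial sum of index 0 is empty; only from index 1 on are the partial sums constant, hence
   the shift. *)
apply: cvg_lim => //; rewrite -(cvg_shiftS _); apply: cvg_near_cst.
apply: nearW => k; rewrite /pseries /series /= big_nat_recl//= big1 ?addr0.
  by rewrite expr0 mulr1 /exp_coef /= divr1.
by move=> j _; rewrite expr0n mulr0.
Qed.

Lemma exp_flow_ode x : linear_ode A (exp_flow x).
Proof.
move=> t i.
have -> : (fun u => exp_flow x u i 0) =
    (fun u => limn (pseries (exp_coef x i) u)) by apply/funext=> u; rewrite mxE.
have -> : (A *m exp_flow x t) i 0 =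
    limn (pseries (pseries_diffs (exp_coef x i)) t).
  apply/esym/cvg_lim => //; rewrite exp_coef_diffs mxE.
  have -> : pseries (exp_coef (A *m x) i) t =
      (fun m => \sum_j A i j * pseries (exp_coef x j) t m).
    apply/funext => m; rewrite /pseries /series /=.
    under eq_bigr do rewrite exp_coef_mulmx mulr_suml.
    rewrite exchange_big; apply: eq_bigr => j _; rewrite mulr_sumr.
    by apply: eq_bigr => k _; rewrite mulrA.
  apply: cvg_big => [|j _]; first exact: add_continuous.
  rewrite mxE; apply: cvgMl_tmp.
  exact: cvg_exp_coef.
(* Termwise differentiation at [t] asks that the series and its first two formal derivatives
   converge at some point of larger modulus. *)
apply: (@pseries_snd_diffs _ _ (`|t| + 1)); rewrite ?exp_coef_diffs;
  try exact: cvg_exp_coef.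
by rewrite [ltRHS]ger0_norm ?addr_ge0// ltrDl.
Qed.

End LinearODE.

(** * Spectra and solutions of the Sylvester and Lyapunov equations *)

Lemma eigenvalue_det (F : fieldType) n (A : 'M[F]_n) (a : F) :
  eigenvalue A a = (\det (a%:M - A) == 0).
Proof.
apply/eigenvalueP/det0P => -[v].
  by move=> vA v0; exists v; rewrite // mulmxBr mul_mx_scalar vA subrr.
by move=> v0; rewrite mulmxBr mul_mx_scalar => /eqP;
  rewrite subr_eq0 => /eqP vA; exists v.
Qed.

Lemma eigenvalue_trmx (F : fieldType) n (A : 'M[F]_n) (a : F) :
  eigenvalue A^T a = eigenvalue A a.
Proof. by rewrite !eigenvalue_det -[in RHS]det_tr linearB /= tr_scalar_mx. Qed.

Lemma horner_mx_intertwine (F : comNzRingType) m n (A : 'M[F]_m.+1)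
    (B : 'M[F]_n.+1) (S : 'M[F]_(m.+1, n.+1)) (p : {poly F}) :
  A *m S = S *m B -> horner_mx A p *m S = S *m horner_mx B p.
Proof.
move=> ASB; elim/poly_ind: p => [|p c IHp]; first by rewrite !rmorph0 mul0mx mulmx0.
rewrite !rmorphD !rmorphM /= !horner_mx_X !horner_mx_C mulmxDl mulmxDr.
by rewrite -!mulmxE -mulmxA ASB mulmxA IHp mulmxA scalar_mxC.
Qed.

(** For [p] the characteristic polynomial of [A], p(A) S = S p(B) with p(A) = 0, while p(B) is a
    product of factors [B - z] over eigenvalues [z] of [A], each of them invertible. *)
Lemma sylvester_eq0 (F : closedFieldType) m n (A : 'M[F]_m.+1) (B : 'M[F]_n.+1)
    (S : 'M[F]_(m.+1, n.+1)) :
  (forall a, eigenvalue A a -> ~~ eigenvalue B a) -> A *m S = S *m B -> S = 0.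
Proof.
move=> AB /(horner_mx_intertwine (char_poly A)).
rewrite Cayley_Hamilton mul0mx => /esym.
suff /mulmxK K : horner_mx B (char_poly A) \in unitmx.
  move=> /(congr1 (mulmx^~ (invmx (horner_mx B (char_poly A))))).
  by rewrite K mul0mx.
have [r charA] := closed_field_poly_normal (char_poly A).
rewrite (monicP (char_poly_monic A)) scale1r in charA.
rewrite [X in horner_mx B X]charA rmorph_prod big_seq.
apply: (big_ind (fun u => u \in GRing.unit)) => [|u w uU wU|z zr].
- exact: unitr1.
- by rewrite unitrMl.
- rewrite rmorphB /= horner_mx_X horner_mx_C -opprB unitrN unitmxE unitfE.
  by rewrite -eigenvalue_det AB// eigenvalue_root_char charA root_prod_XsubC.
Qed.

Lemma hurwitz_lyapunov_eq0 (R : realType) n (A S : 'M[R]_n) :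
  hurwitz A -> A *m S + S *m A^T = 0 -> S = 0.
Proof.
case: n A S => [|n] A S hA AS; first by apply/matrixP => -[].
apply/eqP; rewrite -(map_mx_eq0 (real_complex R)); apply/eqP.
apply: (@sylvester_eq0 _ _ _ (map_mx (real_complex R) A)
          (- (map_mx (real_complex R) A)^T)); last first.
  rewrite mulmxN; apply/eqP; rewrite -addr_eq0 map_trmx -!map_mxM -map_mxD AS.
  by rewrite map_mx0.
(* A common eigenvalue [a] of [A] and [- A^T] would make [- a] an eigenvalue of [A], but [a] and
   [- a] cannot both have negative real part. *)
move=> a /hA a0; apply/negP => /eigenvalueP[v vA v0].
have /hA : complex_eigenvalue A (- a).
  rewrite /complex_eigenvalue -eigenvalue_trmx; apply/eigenvalueP; exists v => //.
  by rewrite scaleNr -vA mulmxN opprK.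
by rewrite raddfN /= oppr_lt0 ltNge (ltW a0).
Qed.

(** The witness is the real part of the Hermitian product of an eigenvector with itself. The case
    [b = 0] is covered, which is what gives (G1). *)
Lemma imaginary_eigenvalue_lyapunov (R : realType) n (A : 'M[R]_n) (b : R) :
  complex_eigenvalue A (Complex 0 b) ->
  exists S : 'M[R]_n, [/\ S^T = S, S != 0 & A *m S + S *m A^T = 0].
Proof.
(* [eigenvalue] speaks of row vectors; after transposition, [v^T] is a column eigenvector of [A]. *)
rewrite /complex_eigenvalue -eigenvalue_trmx map_trmx.
move=> /eigenvalueP[v vA v0].
pose x : 'rV[R]_n := \row_j complex.Re (v 0 j).
pose y : 'rV[R]_n := \row_j complex.Im (v 0 j).
have ReE : x *m A^T = - b *: y.
  apply/rowP => j; have /rowP/(_ j)/(congr1 (@complex.Re R)) := vA.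
  rewrite !mxE raddf_sum /=; case: (v 0 j) => vx vy /=.
  rewrite mul0r sub0r mulNr => <-; apply: eq_bigr => k _.
  by rewrite !mxE; case: (v 0 k) => a c /=; rewrite mulr0 subr0.
have ImE : y *m A^T = b *: x.
  apply/rowP => j; have /rowP/(_ j)/(congr1 (@complex.Im R)) := vA.
  rewrite !mxE raddf_sum /=; case: (v 0 j) => vx vy /=.
  rewrite mul0r add0r => <-; apply: eq_bigr => k _.
  by rewrite !mxE; case: (v 0 k) => a c /=; rewrite mulr0 add0r.
have ReE' : A *m x^T = - b *: y^T by rewrite -[A]trmxK -trmx_mul ReE linearZ.
have ImE' : A *m y^T = b *: x^T by rewrite -[A]trmxK -trmx_mul ImE linearZ.
exists (x^T *m x + y^T *m y); split.
- by rewrite linearD /= !trmx_mul !trmxK.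
(* The diagonal entries are sums of squares of the real and imaginary parts of the entries of
   [v]. *)
- apply: contraNneq v0 => S0; apply/eqP/rowP => j; rewrite mxE.
  have /matrixP/(_ j j) := S0; rewrite !mxE !big_ord1 !mxE => /eqP.
  rewrite paddr_eq0 -?expr2 ?sqr_ge0// !sqrf_eq0 => /andP[/eqP+ /eqP].
  by case: (v 0 j) => a c /= -> ->.
- rewrite mulmxDr mulmxDl !mulmxA ReE' ImE' -!mulmxA ReE ImE.
  rewrite -!scalemxAr -!scalemxAl !scaleNr.
  by rewrite !addrA addrK addNr.
Qed.

(** * Identification of the Schläflian matrix and the guardian property *)

Section Schlaflian.
Variables (R : realType) (n : nat).
Implicit Types (A : 'M[R]_n).

(** Product rule: along [z' = A z], the derivative of [z z^T] is [A z z^T + z z^T A^T]. *)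
Lemma lyapunov_mx_schlaflian2 A : is_lower_schlaflian2 A (lyapunov_mx A).
Proof.
move=> z zA t k.
have -> : (fun u => s2 (z u) k 0) =
    (fun u => z u (deg2_index k).1 0) * (fun u => z u (deg2_index k).2 0).
  by apply/funext => u; rewrite s2E !mxE big_ord1 mxE.
apply: is_derive_eq; first exact: is_deriveM.
rewrite s2E lyapunov_mx_vech; last by rewrite trmx_mul trmxK.
rewrite mulmxA -[z t *m _ *m _]mulmxA -trmx_mul.
by move: (A *m z t) => w; rewrite !mxE !big_ord1 !mxE /GRing.scale /=; ring.
Qed.

Lemma lower_schlaflian2E A : lower_schlaflian2 A = lyapunov_mx A.
Proof.
apply: xget_unique; first exact: lyapunov_mx_schlaflian2.
move=> L LA; apply/eqP; rewrite -subr_eq0; apply/eqP/s2_separates => x.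
apply/colP => k; rewrite mulmxBl mxE [RHS]mxE [in X in _ + X]mxE.
apply/eqP; rewrite subr_eq0; apply/eqP; rewrite -(exp_flow0 A x).
(* Both matrices compute the derivative at time 0 of [s2] along the flow from [x], so they agree on
   [s2 x]. *)
have d1 := LA _ (exp_flow_ode A x) 0 k.
have d2 := lyapunov_mx_schlaflian2 (exp_flow_ode A x) 0 k.
by rewrite -(@derive_val _ _ _ _ _ _ _ d1) -(@derive_val _ _ _ _ _ _ _ d2).
Qed.

Lemma lyapunov_mx_linear : linear (@lyapunov_mx R n).
Proof.
move=> a A B.
have vechP C v : lyapunov_vech C v = vech (C *m unvech v + unvech v *m C^T) by [].
apply/matrixP => k l; rewrite mxE [RHS]mxE [X in _ = X + _]mxE.
rewrite [lyapunov_mx A k l]mxE [lyapunov_mx B k l]mxE !vechP.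
rewrite [(a *: A + B)^T]linearP mulmxDl mulmxDr -!scalemxAl -scalemxAr.
by rewrite addrACA -scalerDr linearP /= mxE [X in X + _ = _]mxE.
Qed.

(** In the commutator of the two Lyapunov operators the mixed terms [A S B^T] and [B S A^T] cancel.
    Testing on [S = z z^T] suffices. *)
Lemma lyapunov_mx_bracket A B :
  lyapunov_mx (lie_bracket A B) = lie_bracket (lyapunov_mx A) (lyapunov_mx B).
Proof.
have sym C S : S^T = S -> (C *m S + S *m C^T)^T = C *m S + S *m C^T :> 'M[R]_n.
  by move=> Ssym; rewrite linearD /= !trmx_mul trmxK Ssym addrC.
apply/eqP; rewrite -subr_eq0; apply/eqP/s2_separates => z.
have zsym : (z *m z^T)^T = z *m z^T by rewrite trmx_mul trmxK.
rewrite s2E /lie_bracket !mulmxBl -!mulmxA.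
rewrite !lyapunov_mx_vech ?sym//.
move: (z *m z^T) => S; rewrite -!linearB /= [X in vech X](_ : _ = 0) ?linear0//.
rewrite linearB /= !trmx_mul !(mulmxBl, mulmxBr, mulmxDl, mulmxDr) !mulmxA.
by apply/matrixP => i j; rewrite !mulNmx !mxE; ring.
Qed.

Lemma det_lyapunov_mx_eq0 A :
  (\det (lyapunov_mx A) == 0) <->
  exists S : 'M[R]_n, [/\ S^T = S, S != 0 & A *m S + S *m A^T = 0].
Proof.
(* [det0P] yields row vectors; transposing makes them kernel columns, which [unvech] identifies with
   symmetric matrices. *)
rewrite -det_tr; split.
  case/det0P => r r0 /(congr1 trmx); rewrite trmx_mul trmxK trmx0 => Lr.
  exists (unvech r^T); split; first exact: unvech_sym.
    apply: contraNneq r0 => /(congr1 (@vech R n)).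
    by rewrite unvechK linear0 => /(congr1 trmx); rewrite trmxK trmx0 => ->.
  move: Lr; rewrite lyapunov_mxE /lyapunov_vech => /(congr1 (@unvech R n)).
  rewrite vechK ?linear0// linearD /= !trmx_mul trmxK unvech_sym.
  by rewrite addrC.
case=> S [Ssym S0 AS]; apply/det0P; exists (vech S)^T.
  apply: contraNneq S0 => /(congr1 trmx); rewrite trmxK trmx0.
  by move=> /(congr1 (@unvech R n)); rewrite vechK// linear0 => ->.
by rewrite -trmx_mul lyapunov_mx_vech// AS linear0 trmx0.
Qed.

End Schlaflian.

Theorem proposition3 (R : realType) (n : nat) (hn : (1 <= n)%N) :
  @guardian_representation R n 'C(n.+1, 2) (fun A => lower_schlaflian2 A).
Proof.
have -> : (fun A : 'M[R]_n => lower_schlaflian2 A) = @lyapunov_mx R n.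
  by apply/funext => A; exact: lower_schlaflian2E.
split; first by split; [exact: lyapunov_mx_linear|exact: lyapunov_mx_bracket].
left; split=> A.
  move=> hA /eqP/det_lyapunov_mx_eq0[S [_ /eqP S0 /(hurwitz_lyapunov_eq0 hA)]].
  exact: S0.
move=> [[a b] [ev /= a0]]; apply/eqP/det_lyapunov_mx_eq0.
by apply: (@imaginary_eigenvalue_lyapunov _ _ _ b); rewrite -a0.
Qed.
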